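(* Let $S(K_{1,n})$ be the splitting graph of the star graph $K_{1,n}$. Then for $n\geq 2$, $F_d[S(K_{1,n})]=2n-1$.
   Context: The star $K_{1,n}$ has one vertex of degree $n$ adjacent to $n$ vertices of degree $1$. The splitting graph $S(G)$ of a graph $G$ is obtained from $G$ by adding, for each vertex $v$ of $G$, a new vertex $v'$ and joining $v'$ to all vertices of $G$ adjacent to $v$ in $G$ (the new vertices are pairwise nonadjacent). Zero forcing: given a set $B\subseteq V(G)$ of initially black vertices (all others white) of a finite simple graph $G$, at each step a black vertex having exactly one white neighbor forces that neighbor to become black; $B$ is a zero forcing set of $G$ if repeated application of this rule turns all vertices black. A set $D\subseteq V(G)$ is dominating if every vertex of $G$ is in $D$ or adjacent to a vertex of $D$. A dom-forcing set of $G$ is a set $D_f\subseteq V(G)$ that is both a dominating set of $G$ and a zero forcing set of $G$; the dom-forcing number $F_d(G)$ is the minimum cardinality of a dom-forcing set. *)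

(* Defs.v *)
From HB Require Import structures.
From mathcomp Require Import all_boot.

Set Implicit Arguments.
Unset Strict Implicit.
Unset Printing Implicit Defensive.

Record sgraph := SGraph {
  vertex :> finType;
  adj : rel vertex;
  adj_sym : symmetric adj;
  adj_irr : irreflexive adj
}.

(* The centre is [None] and the leaves are the [Some i], i < n. *)
Definition star_adj (n : nat) : rel (option 'I_n) :=
  fun x y => isSome x != isSome y.

Lemma star_adj_sym n : symmetric (@star_adj n).
Proof. by move=> x y; rewrite /star_adj eq_sym. Qed.

Lemma star_adj_irr n : irreflexive (@star_adj n).
Proof. by move=> x; rewrite /star_adj eqxx. Qed.

Definition star (n : nat) : sgraph :=
  SGraph (@star_adj_sym n) (@star_adj_irr n).

(* [inl v] is the original vertex v and [inr v] is the added vertex v'. *)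
Definition splitting_adj (G : sgraph) : rel (G + G)%type :=
  fun x y => match x, y with
             | inl u, inl v => adj u v
             | inl u, inr v => adj u v
             | inr u, inl v => adj u v
             | inr _, inr _ => false
             end.

Lemma splitting_adj_sym (G : sgraph) : symmetric (@splitting_adj G).
Proof. by move=> [u|u] [v|v] //=; apply: adj_sym. Qed.

Lemma splitting_adj_irr (G : sgraph) : irreflexive (@splitting_adj G).
Proof. by move=> [u|u] //=; apply: adj_irr. Qed.

Definition splitting (G : sgraph) : sgraph :=
  SGraph (@splitting_adj_sym G) (@splitting_adj_irr G).

Definition white_neighbors (G : sgraph) (B : {set G}) (u : G) : {set G} :=
  [set w | adj u w & w \notin B].

(* One application of the colour-change rule: the set of black vertices goes
   from B to B' because some black u forces its only white neighbour v. *)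
Definition force_step (G : sgraph) : rel {set G} :=
  fun B B' => [exists u in B, exists v,
    (white_neighbors B u == [set v]) && (B' == v |: B)].

Definition zero_forcing (G : sgraph) (B : {set G}) : bool :=
  connect (@force_step G) B [set: G].

Definition dominating (G : sgraph) (D : {set G}) : bool :=
  [forall v, (v \in D) || [exists u in D, adj v u]].

Definition dom_forcing (G : sgraph) (D : {set G}) : bool :=
  dominating D && zero_forcing D.

(* [set: G] is only the seed of the search for a minimiser; it is always a
   dom-forcing set, so the minimum is over a nonempty family. *)
Definition dom_forcing_number (G : sgraph) : nat :=
  #|[arg min_(D < [set: G] | dom_forcing D) #|D|]|.

Lemma dom_forcing_setT (G : sgraph) : dom_forcing [set: G].
Proof.
apply/andP; split; last exact: connect0.
by apply/forallP => v; rewrite inE.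
Qed.

Lemma dom_forcing_number_min (G : sgraph) :
  (exists2 D : {set G}, dom_forcing D & #|D| = dom_forcing_number G) /\
  (forall D : {set G}, dom_forcing D -> dom_forcing_number G <= #|D|).
Proof.
rewrite /dom_forcing_number.
case: arg_minnP => [|D hD minD]; first exact: dom_forcing_setT.
by split; first by exists D.
Qed.

(* Main.v *)
Require Import Defs.
From mathcomp Require Import all_boot.

(** Write [c] for the centre, [v_i] for the leaves and [c'], [v_i'] for their
    copies.  The [v_i] all have neighbourhood [{c, c'}] and the [v_i'] all have
    neighbourhood [{c}]; no vertex ever forces one of two white twins, so a zero
    forcing set misses at most one [v_i] and at most one [v_i'].  If it is
    dominating and misses some [v_i'], it contains [c].  Hence at most three of
    the [2n + 2] vertices are missing, and the complement of [{c', v_0, v_0'}]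
    attains this bound: [v_1] forces [c'], then [c'] forces [v_0] and [c] forces
    [v_0']. *)

Lemma zero_forcing_step (G : sgraph) (B : {set G}) (u v : G) :
  u \in B -> adj u v -> (forall w, adj u w -> w \in v |: B) ->
  zero_forcing (v |: B) -> zero_forcing B.
Proof.
move=> uB uv onlyv; have [vB|vB] := boolP (v \in B).
  by rewrite (setUidPr _) // sub1set.
apply: connect_trans; apply: connect1.
apply/existsP; exists u; rewrite uB /=.
apply/existsP; exists v; rewrite eqxx andbT.
apply/eqP/setP=> w; rewrite !inE.
apply/andP/eqP=> [[uw wB]|->]; last by split.
by move: (onlyv w uw); rewrite !inE (negbTE wB) orbF => /eqP.
Qed.

(** A forcing [u] sees both twins or neither, so while both are white neither is its unique white
    neighbour. *)
Lemma zero_forcing_twins (G : sgraph) (B : {set G}) (x y : G) :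
  zero_forcing B -> (forall u, adj u x = adj u y) ->
  x \notin B -> y \notin B -> x = y.
Proof.
move=> /connectP[p pathp lastp] twins; elim: p B pathp lastp => [|C p IHp] B /=.
  by move=> _ <-; rewrite inE.
case/andP=> /existsP[u /andP[_ /existsP[v /andP[/eqP Nu /eqP ->]]]] pathp lastp.
move=> xB yB; have Nuxy : (x == v) = (y == v).
  by move/setP: Nu => Nu; move: (Nu x) (Nu y); rewrite !inE xB yB !andbT twins => <- <-.
have [xv|xv] := eqVneq x v.
  by move: Nuxy; rewrite xv eqxx => /esym/eqP.
by apply: (IHp (v |: B)); rewrite // !inE negb_or -?Nuxy xv.
Qed.

Lemma card_splitting_star (n : nat) : #|splitting (star n)| = 2 * n + 2.
Proof. by rewrite card_sum card_option card_ord mul2n -addnn addn2 addSn addnS. Qed.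

Lemma card_dom_forcing_splitting_star (n : nat) (D : {set splitting (star n)}) :
  dom_forcing D -> 2 * n - 1 <= #|D|.
Proof.
case/andP=> /forallP dom zf.
have centre i : inr (Some i) \notin D -> inl None \in D.
  move=> iD; move: (dom (inr (Some i))); rewrite (negbTE iD) /=.
  by case/existsP=> -[[j|]|[j|]] /andP[].
(* [c] and the [v_i'] share a class since they are never white together. *)
pose class (x : splitting (star n)) : option bool :=
  match x with
  | inr None => None
  | inl (Some _) => Some true
  | _ => Some false
  end.
have class_inj : {in ~: D &, injective class}.
  move=> x y; rewrite !inE => xD yD.
  case: x xD => [[i|]|[i|]] xD; case: y yD => [[j|]|[j|]] yD //= _.
  - exact: (zero_forcing_twins _ _ _ _ zf).
  - by rewrite (centre j yD) in xD.
  - by rewrite (centre i xD) in yD.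
  - exact: (zero_forcing_twins _ _ _ _ zf).
have white3 : #|~: D| <= 3.
  by rewrite -(card_in_imset class_inj) (leq_trans (max_card _)) // card_option card_bool.
(* Adding 2 makes the left side the vertex count [#|D| + #|~: D|]. *)
rewrite leq_subLR -(leq_add2r 2) -card_splitting_star -(cardsC D).
by rewrite addnAC addnC leq_add2r.
Qed.

Lemma dom_forcing_splitting_star (n : nat) :
  2 <= n ->
  exists2 D : {set splitting (star n)}, dom_forcing D & #|D| = 2 * n - 1.
Proof.
(* Having two leaves makes [ord_max] differ from [ord0], so [v ord_max] starts black. *)
case: n => [|[|n]] // _.
pose c : splitting (star n.+2) := inl None.
pose c' : splitting (star n.+2) := inr None.
pose v i : splitting (star n.+2) := inl (Some i).
pose v' i : splitting (star n.+2) := inr (Some i).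
pose W : {set splitting (star n.+2)} := [set c'; v ord0; v' ord0].
exists (~: W); last first.
  by rewrite cardsCs setCK card_splitting_star /W -setUA !cardsU1 cards1 !inE /= !addn1 addn2 subSS subSS subn1.
apply/andP; split.
  (* Even black vertices get a black neighbour: [c] for leaves and their copies, [v ord_max] for [c]
     and [c']. *)
  apply/forallP=> x; apply/orP; right; apply/existsP.
  case: x => [[i|]|[i|]].
  - by exists c; rewrite !inE.
  - by exists (v ord_max); rewrite !inE.
  - by exists c; rewrite !inE.
  - by exists (v ord_max); rewrite !inE.
apply: (@zero_forcing_step _ _ (v ord_max) c'); rewrite ?inE //.
  by case=> [[i|]|[i|]]; rewrite ?inE.
apply: (@zero_forcing_step _ _ c' (v ord0)); rewrite ?inE //.
  by case=> [[i|]|[i|]]; rewrite ?inE //= => _; case: eqP => //= ->; rewrite ?eqxx.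
(* [c] is also adjacent to [v ord0], so this force must come after that of [c']. *)
apply: (@zero_forcing_step _ _ c (v' ord0)); rewrite ?inE //.
  by case=> [[i|]|[i|]]; rewrite ?inE //= => _; rewrite ?orbF ?orbN ?orNb //; case: eqP.
suff -> : v' ord0 |: (v ord0 |: (c' |: ~: W)) = setT by exact: connect0.
apply/setP=> x; rewrite !inE.
by do 3![case: eqP => //= _].
Qed.

Theorem theorem5p11 (n : nat) (hn : 2 <= n) :
  dom_forcing_number (splitting (star n)) = 2 * n - 1.
Proof.
have [[D domD cardD] minD] := dom_forcing_number_min (splitting (star n)).
have [E domE cardE] := dom_forcing_splitting_star _ hn.
apply/eqP; rewrite eqn_leq -{1}cardE minD //= -cardD.
exact: card_dom_forcing_splitting_star.
Qed.
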